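(* Let $W=W(\Gamma,\mathbf m)$ be a graph product of directly-indecomposable cyclic groups, let $1\le i\le N$, and let $\mathcal L_i\subset\mathcal P$ be the set of partial conjugations for which $v_i$ is a link point. Then the natural restriction homomorphism $$\rho_i:\langle\mathcal L_i\rangle\to\operatorname{Aut}^0W(L_i),\qquad \phi\mapsto\phi|_{W(L_i)},$$ is injective.
   Context: $\Gamma$ is a finite simplicial graph with non-empty vertex set $V=\{v_1,\dots,v_N\}$. An order map is a function $\mathbf m:\{1,\dots,N\}\to\{p^\alpha : p \text{ prime},\ \alpha\ge 1\}\cup\{\infty\}$. The graph product of directly-indecomposable cyclic groups $W=W(\Gamma,\mathbf m)$ is the group with generators $V$ and relations $v_i^{\mathbf m(i)}=1$ (no relation if $\mathbf m(i)=\infty$) and $v_jv_k=v_kv_j$ whenever $v_j,v_k$ are adjacent in $\Gamma$. For a full subgraph $\Delta$, $W(\Delta)$ is the subgroup generated by the vertices of $\Delta$; it is naturally the graph product associated to $\Delta$ with the restricted labels. $L_i$ (resp. $S_i$) is the link (resp. star) of $v_i$: the full subgraph on the vertices at distance exactly $1$ (resp. at most $1$) from $v_i$. $\operatorname{Aut}^0$ of a graph product is the group of automorphisms which map each vertex to a conjugate of itself. For $1\le j\le N$ and $Q$ a connected component of $\Gamma\setminus S_j$, the partial conjugation $\chi_{jQ}$ is the automorphism of $W$ with $\chi_{jQ}(v_k)=v_jv_kv_j^{-1}$ if $v_k\in Q$ and $\chi_{jQ}(v_k)=v_k$ if $v_k\notin Q$. $\mathcal P$ is the set of all partial conjugations.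 A vertex $v_i$ is a link point of $\chi_{jQ}$ if $v_j\in L_i$ and $Q\cap L_i\ne\emptyset$. *)

(* Defs.v *)
From HB Require Import structures.
From mathcomp Require Import all_boot.
From mathcomp Require Import boolp classical_sets.

Set Implicit Arguments.
Unset Strict Implicit.
Unset Printing Implicit Defensive.

Local Open Scope group_scope.
Local Open Scope quotient_scope.

Section Presentation.
Variable X : choiceType.

(* The letter (x, false) stands for x, and (x, true) for x^-1. *)
Definition word : Type := seq (X * bool).

Variable R : word -> word -> Prop.

Inductive word_cong : word -> word -> Prop :=
| cong_refl u : word_cong u u
| cong_sym u v : word_cong u v -> word_cong v u
| cong_trans u v w : word_cong u v -> word_cong v w -> word_cong u w
| cong_cancel u v x b : word_cong (u ++ [:: (x, b); (x, ~~ b)] ++ v) (u ++ v)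
| cong_rel u v r s : R r s -> word_cong (u ++ r ++ v) (u ++ s ++ v).

Lemma cong_catl w u v : word_cong u v -> word_cong (w ++ u) (w ++ v).
Proof.
elim=> [a|a b _|a b c _ hab _|a b x c|a b r s hrs].
- exact: cong_refl.
- exact: cong_sym.
- exact: cong_trans.
- by have := cong_cancel (w ++ a) b x c; rewrite -!catA.
- by have := cong_rel (w ++ a) b hrs; rewrite -!catA.
Qed.

Lemma cong_catr w u v : word_cong u v -> word_cong (u ++ w) (v ++ w).
Proof.
elim=> [a|a b _|a b c _ hab _|a b x c|a b r s hrs].
- exact: cong_refl.
- exact: cong_sym.
- exact: cong_trans.
- by have := cong_cancel a (b ++ w) x c; rewrite -!catA.
- by have := cong_rel a (b ++ w) hrs; rewrite -!catA.
Qed.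

Definition word_congb : rel (seq (X * bool)) := fun u v => `[< word_cong u v >].

Lemma word_congb_refl : reflexive word_congb.
Proof. by move=> u; apply/asboolP/cong_refl. Qed.

Lemma word_congb_sym : symmetric word_congb.
Proof. by move=> u v; apply/asboolP/asboolP; exact: cong_sym. Qed.

Lemma word_congb_trans : transitive word_congb.
Proof. by move=> v u w /asboolP uv /asboolP vw; apply/asboolP/(cong_trans uv). Qed.

Canonical word_cong_equiv :=
  EquivRel word_congb word_congb_refl word_congb_sym word_congb_trans.

Definition presented : Type := {eq_quot word_congb}.

HB.instance Definition _ := Choice.on presented.
HB.instance Definition _ := EqQuotient.on presented.

Definition word_class (w : word) : presented := \pi_presented w.

Lemma word_classP u v : word_class u = word_class v <-> word_cong u v.
Proof. by split=> [/eqmodP/asboolP|uv]; last exact/eqmodP/asboolP. Qed.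

Lemma word_classW (P : presented -> Prop) :
  (forall w, P (word_class w)) -> forall x, P x.
Proof. by move=> Pw x; rewrite -(reprK x); exact: Pw. Qed.

Lemma repr_word_class w : word_cong (repr (word_class w)) w.
Proof. by apply/word_classP; rewrite /word_class reprK. Qed.

Definition inv_word (w : word) : word := rev [seq (l.1, ~~ l.2) | l <- w].

Lemma inv_wordK : involutive inv_word.
Proof.
move=> w; rewrite /inv_word map_rev revK -map_comp.
by elim: w => //= -[x b] w ->; rewrite negbK.
Qed.

Lemma inv_word_cat u v : inv_word (u ++ v) = inv_word v ++ inv_word u.
Proof. by rewrite /inv_word map_cat rev_cat. Qed.

Lemma cat_inv_word w : word_cong (w ++ inv_word w) [::].
Proof.
elim: w => [|[x b] w IH]; first exact: cong_refl.
have -> : ((x, b) :: w) ++ inv_word ((x, b) :: w) =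
  [:: (x, b)] ++ (w ++ inv_word w) ++ [:: (x, ~~ b)].
  by rewrite -cat1s inv_word_cat -!catA.
apply: cong_trans (cong_catl _ (cong_catr _ IH)) _.
exact: cong_cancel [::] [::] x b.
Qed.

Lemma inv_word_cong u v : word_cong u v -> word_cong (inv_word u) (inv_word v).
Proof.
move=> uv.
have h1 : word_cong (inv_word u ++ (v ++ inv_word v)) (inv_word u).
  by rewrite -[X in word_cong _ X]cats0; exact/cong_catl/cat_inv_word.
apply: cong_trans (cong_sym h1) _; rewrite catA.
apply: cong_trans (cong_catr _ (cong_catl _ (cong_sym uv))) _.
have /(cong_catr (inv_word v)) := cat_inv_word (inv_word u).
by rewrite inv_wordK.
Qed.

Definition presented_one := word_class [::].
Definition presented_mul (x y : presented) := word_class (repr x ++ repr y).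
Definition presented_inv (x : presented) := word_class (inv_word (repr x)).

Lemma presented_mulE u v :
  presented_mul (word_class u) (word_class v) = word_class (u ++ v).
Proof.
apply/word_classP/(cong_trans (cong_catl _ (repr_word_class v))).
exact/cong_catr/repr_word_class.
Qed.

Lemma presented_invE w :
  presented_inv (word_class w) = word_class (inv_word w).
Proof. exact/word_classP/inv_word_cong/repr_word_class. Qed.

Lemma presented_mulA : associative presented_mul.
Proof.
elim/word_classW=> u; elim/word_classW=> v; elim/word_classW=> w.
by rewrite !presented_mulE catA.
Qed.

Lemma presented_mul1 : left_id presented_one presented_mul.
Proof. by elim/word_classW=> w; rewrite presented_mulE. Qed.

Lemma presented_mulr1 : right_id presented_one presented_mul.
Proof. by elim/word_classW=> w; rewrite presented_mulE cats0. Qed.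

Lemma presented_mulVr : right_inverse presented_one presented_inv presented_mul.
Proof.
elim/word_classW=> w; rewrite presented_invE presented_mulE.
exact/word_classP/cat_inv_word.
Qed.

Lemma presented_mulVl : left_inverse presented_one presented_inv presented_mul.
Proof.
elim/word_classW=> w; rewrite presented_invE presented_mulE.
by apply/word_classP; have := cat_inv_word (inv_word w); rewrite inv_wordK.
Qed.

HB.instance Definition _ := isGroup.Build presented presented_mulA
  presented_mul1 presented_mulr1 presented_mulVl presented_mulVr.

Lemma word_class_cat u v : word_class (u ++ v) = word_class u * word_class v.
Proof. by rewrite -presented_mulE. Qed.

Definition pgen (x : X) : presented := word_class [:: (x, false)].

Section Universal.
Variables (H : groupType) (f : X -> H).

Definition word_eval (w : word) : H :=
  \prod_(l <- w) (if l.2 then (f l.1)^-1 else f l.1).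

Lemma word_eval_cat u v : word_eval (u ++ v) = word_eval u * word_eval v.
Proof. by rewrite /word_eval big_cat. Qed.

Hypothesis fR : forall r s, R r s -> word_eval r = word_eval s.

Lemma word_eval_cong u v : word_cong u v -> word_eval u = word_eval v.
Proof.
elim=> [//|//|a b c _ -> _ -> //|a b x c|a b r s hrs]; last first.
  by rewrite !word_eval_cat (fR hrs).
rewrite !word_eval_cat; congr (_ * _).
rewrite {1}/word_eval big_cons big_seq1 /=.
by case: c; rewrite /= ?mulVg ?mulgV mul1g.
Qed.

Definition presented_lift (x : presented) : H := word_eval (repr x).

Lemma presented_lift_class w : presented_lift (word_class w) = word_eval w.
Proof. exact/word_eval_cong/repr_word_class. Qed.

Lemma presented_liftM : {morph presented_lift : x y / x * y}.
Proof.
elim/word_classW=> u; elim/word_classW=> v.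
by rewrite -word_class_cat !presented_lift_class word_eval_cat.
Qed.

Lemma presented_lift_gen x : presented_lift (pgen x) = f x.
Proof. by rewrite presented_lift_class /word_eval big_seq1. Qed.

End Universal.

Lemma presented_ext (H : groupType) (f g : presented -> H) :
    {morph f : x y / x * y} -> {morph g : x y / x * y} ->
  (forall x, f (pgen x) = g (pgen x)) -> f =1 g.
Proof.
move=> fM gM fg.
have f1 : f 1 = 1 by apply: (@mulgI _ (f 1)); rewrite -fM !mulg1.
have g1 : g 1 = 1 by apply: (@mulgI _ (g 1)); rewrite -gM !mulg1.
elim/word_classW; elim=> [|[x b] w IH]; first exact: etrans f1 (esym g1).
rewrite -cat1s word_class_cat fM gM IH; congr (_ * _).
case: b; last exact: fg.
have -> : word_class [:: (x, true)] = (pgen x)^-1.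
  by symmetry; exact: (presented_invE [:: (x, false)]).
apply: (@mulgI _ (f (pgen x))).
by rewrite -fM fg -gM !mulgV f1 g1.
Qed.

End Presentation.

Section Generated.
Variables (G : groupType) (A : set G).

Inductive generated : G -> Prop :=
| generated_in x : A x -> generated x
| generated1 : generated 1
| generatedM x y : generated x -> generated y -> generated (x * y)
| generatedV x : generated x -> generated x^-1.

Definition generatedb : pred G := fun x => `[< generated x >].

Record gengroup : Type := GenGroup { gengroup_val : G; _ : generatedb gengroup_val }.

HB.instance Definition _ := [isSub for gengroup_val].
HB.instance Definition _ := [Choice of gengroup by <:].

Lemma generated_group_closed : group_closed generatedb.
Proof.
split; first exact/asboolP/generated1.
move=> x y /asboolP gx /asboolP gy.
exact/asboolP/(generatedM gx)/generatedV.
Qed.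

HB.instance Definition _ :=
  SubChoice_isSubGroup.Build G generatedb gengroup generated_group_closed.

End Generated.

Section Automorphisms.
Variable G : groupType.

Record aut : Type := Aut {
  aut_fun :> G -> G;
  aut_morph : {morph aut_fun : x y / x * y};
  aut_bij : bijective aut_fun }.

HB.instance Definition _ := gen_eqMixin aut.
HB.instance Definition _ := gen_choiceMixin aut.

Lemma aut_monoid_morphism (f : aut) : monoid_morphism f.
Proof.
split; last exact: aut_morph.
by apply: (@mulgI _ (f 1)); rewrite -aut_morph !mulg1.
Qed.

HB.instance Definition _ (f : aut) :=
  isUMagmaMorphism.Build G G f (aut_monoid_morphism f).

Lemma aut_ext (f g : aut) : f =1 g -> f = g.
Proof.
case: f g => [f fM fB] [g gM gB] /= /funext fg.
by case: g / fg gM gB => gM gB; congr Aut; exact: Prop_irrelevance.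
Qed.

Definition aut_one : aut := Aut (fun x y => erefl) (Bijective (frefl id) (frefl id)).

Lemma aut_mul_morph (f g : aut) : {morph f \o g : x y / x * y}.
Proof. by move=> x y /=; rewrite !gmulfM. Qed.

Definition aut_mul (f g : aut) : aut :=
  Aut (@aut_mul_morph f g) (bij_comp (aut_bij f) (aut_bij g)).

Lemma aut_inv_subproof (f : aut) : exists g : aut, cancel f g /\ cancel g f.
Proof.
have [g fK gK] := aut_bij f.
have gM : {morph g : x y / x * y} by exact: can2_gmulfM fK gK.
by exists (Aut gM (Bijective gK fK)).
Qed.

Definition aut_inv (f : aut) : aut := sval (cid (aut_inv_subproof f)).

Lemma autK (f : aut) : cancel f (aut_inv f).
Proof. by rewrite /aut_inv; case: cid => g []. Qed.

Lemma autVK (f : aut) : cancel (aut_inv f) f.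
Proof. by rewrite /aut_inv; case: cid => g []. Qed.

Lemma aut_mulA : associative aut_mul.
Proof. by move=> f g h; exact: aut_ext. Qed.
Lemma aut_mul1 : left_id aut_one aut_mul.
Proof. by move=> f; exact: aut_ext. Qed.
Lemma aut_mulr1 : right_id aut_one aut_mul.
Proof. by move=> f; exact: aut_ext. Qed.
Lemma aut_mulVl : left_inverse aut_one aut_inv aut_mul.
Proof. by move=> f; apply: aut_ext => x /=; exact: autK. Qed.
Lemma aut_mulVr : right_inverse aut_one aut_inv aut_mul.
Proof. by move=> f; apply: aut_ext => x /=; exact: autVK. Qed.

HB.instance Definition _ :=
  isGroup.Build aut aut_mulA aut_mul1 aut_mulr1 aut_mulVl aut_mulVr.

Lemma aut1E x : (1 : aut) x = x. Proof. by []. Qed.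
Lemma autME (f g : aut) x : (f * g) x = f (g x). Proof. by []. Qed.

(* For a graph product G with vertex set S, this is Aut^0 G. *)
Variable S : set G.

Definition conj_preserving (f : aut) : Prop :=
  forall v, S v -> exists a : G, f v = v ^ a.

Definition conj_preservingb : pred aut := fun f => `[< conj_preserving f >].

Record aut0 : Type := Aut0 { aut0_val : aut; _ : conj_preservingb aut0_val }.

HB.instance Definition _ := [isSub for aut0_val].
HB.instance Definition _ := [Choice of aut0 by <:].

Lemma conj_preserving_group_closed : group_closed conj_preservingb.
Proof.
split; first by apply/asboolP => v _; exists 1; rewrite conjg1.
move=> f g /asboolP hf /asboolP hg; apply/asboolP => v Sv.
have [a ha] := hf v Sv; have [b hb] := hg v Sv.
exists (a * f (g^-1 b^-1)); rewrite autME.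
have gVK : cancel (aut_inv g) g by exact: autVK.
have -> : g^-1 v = v ^ g^-1 b^-1.
  have -> : g^-1 = aut_inv g by [].
  apply: (can_inj (autK g)).
  by rewrite gmulfJ /= !gVK hb conjgK.
by rewrite gmulfJ /= ha conjgM.
Qed.

HB.instance Definition _ :=
  SubChoice_isSubGroup.Build aut conj_preservingb aut0 conj_preserving_group_closed.

End Automorphisms.

(* None stands for infinite order. *)
Definition order_map (V : Type) (m : V -> option nat) : Prop :=
  forall v n, m v = Some n -> exists p a, [/\ prime p, (0 < a)%N & n = (p ^ a)%N].

Section Graph.
Variables (V : finType) (e : rel V).

Definition link (i : V) : {set V} := [set k | e i k].
Definition star (i : V) : {set V} := i |: link i.

Definition induced (A : {set V}) : rel V :=
  fun x y => [&& x \in A, y \in A & e x y].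

Definition components (A : {set V}) : {set {set V}} :=
  equivalence_partition (connect (induced A)) A.

End Graph.

Section GraphProduct.
Variables (V : finType) (e : rel V) (m : V -> option nat).

Inductive graph_rel : word V -> word V -> Prop :=
| graph_rel_order i n : m i = Some n -> graph_rel (nseq n (i, false)) [::]
| graph_rel_comm j k : e j k ->
    graph_rel [:: (j, false); (k, false)] [:: (k, false); (j, false)].

Definition graph_product : Type := presented graph_rel.
HB.instance Definition _ := Group.on graph_product.

Definition vtx (k : V) : graph_product := pgen graph_rel k.

Definition vtx_set (D : {set V}) : set graph_product :=
  fun x => exists2 k, k \in D & x = vtx k.

(* gengroup (vtx_set D) is W(Delta) for the full subgraph Delta on D, and
   subgraph_vtx D is the set of its vertices. *)
Definition subgraph_vtx (D : {set V}) : set (gengroup (vtx_set D)) :=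
  fun x => vtx_set D (val x).

Definition is_partial_conj (j : V) (Q : {set V}) (f : aut graph_product) : Prop :=
  forall k, f (vtx k) = if k \in Q then vtx j * vtx k * (vtx j)^-1 else vtx k.

Definition is_link_point (i j : V) (Q : {set V}) : bool :=
  (j \in link e i) && (Q :&: link e i != finset.set0).

Definition link_conjs (i : V) : set (aut graph_product) :=
  fun f => exists j Q, [/\ Q \in components e (~: star e j),
    is_partial_conj j Q f & is_link_point i j Q].

Lemma vtx_order i n : m i = Some n -> vtx i ^+ n = 1.
Proof.
move=> mi; have -> : vtx i ^+ n = word_class graph_rel (nseq n (i, false)).
  by elim: n {mi} => // n IH; rewrite expgS IH -word_class_cat.
apply/word_classP; have := cong_rel [::] [::] (graph_rel_order mi).
by rewrite cats0.
Qed.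

Lemma vtx_comm j k : e j k -> vtx j * vtx k = vtx k * vtx j.
Proof.
move=> jk; rewrite -!word_class_cat; apply/word_classP.
exact: (cong_rel [::] [::] (graph_rel_comm jk)).
Qed.

(* The formula defining chi_{jQ} is well defined: it extends to a unique
   automorphism. *)
Section PartialConjExists.
Hypothesis e_sym : symmetric e.
Variables (j : V) (Q : {set V}).
Hypothesis Q_comp : Q \in components e (~: star e j).

Lemma comp_notin_star k : k \in Q -> k \notin star e j.
Proof. by case/imsetP: Q_comp => x _ ->; rewrite !inE => /andP[]. Qed.

Lemma comp_closed k l : k \in Q -> e k l -> l \notin star e j -> l \in Q.
Proof.
move=> kQ kl lj; have kj := comp_notin_star kQ; move: kQ.
case/imsetP: Q_comp => x _ ->; rewrite [k \in _]inE [l \in _]inE.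
move=> /andP[_ xk]; rewrite inE lj (connect_trans xk) // connect1 //.
by rewrite /induced !finset.in_setC kj lj kl.
Qed.

Section Endo.
Variables (c : graph_product).
Hypothesis c_comm : forall l, l \in link e j -> commute c (vtx l).

Definition pconj_gen k := if k \in Q then c * vtx k * c^-1 else vtx k.

Lemma pconj_gen_rel r s : graph_rel r s -> word_eval pconj_gen r = word_eval pconj_gen s.
Proof.
case=> [i n mi|k l kl].
  have -> : word_eval pconj_gen (nseq n (i, false)) = pconj_gen i ^+ n.
    elim: n {mi} => [|n IH]; first by rewrite /word_eval big_nil.
    by rewrite expgS -IH /word_eval /= big_cons.
  rewrite /word_eval big_nil /pconj_gen; case: ifP => _; last exact: vtx_order.
  have -> : c * vtx i * c^-1 = vtx i ^ c^-1 by rewrite /conjg invgK mulgA.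
  by rewrite -conjXg vtx_order // conj1g.
rewrite /word_eval !big_cons !big_nil /= !mulg1.
have mixed a b : e a b -> a \in Q -> b \notin Q ->
    c * vtx a * c^-1 * vtx b = vtx b * (c * vtx a * c^-1).
  move=> ab aQ bQ; have cb : commute c (vtx b).
    apply: c_comm; apply: contraR bQ => bl; apply: (comp_closed aQ ab).
    rewrite finset.in_setU1 negb_or bl andbT; apply: contra (comp_notin_star aQ) => /eqP bj.
    by rewrite finset.in_setU1 inE -bj e_sym ab orbT.
  have cVb : c^-1 * vtx b = vtx b * c^-1.
    by apply: (@mulgI _ c); rewrite mulgA mulgV mul1g mulgA cb -mulgA mulgV mulg1.
  by rewrite -!mulgA cVb [vtx a * _]mulgA (vtx_comm ab) !mulgA cb.
rewrite /pconj_gen; case: ifPn => kQ; case: ifPn => lQ.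
- have J x y : c * x * c^-1 * (c * y * c^-1) = c * (x * y) * c^-1.
    by rewrite !mulgA mulgVK.
  by rewrite !J vtx_comm.
- exact: mixed.
- by rewrite mixed // e_sym.
- exact: vtx_comm.
Qed.

Definition pconj_endo : graph_product -> graph_product :=
  presented_lift pconj_gen.

Lemma pconj_endoM : {morph pconj_endo : x y / x * y}.
Proof. exact: presented_liftM pconj_gen_rel. Qed.

Lemma pconj_endo_vtx k : pconj_endo (vtx k) = pconj_gen k.
Proof. exact: presented_lift_gen pconj_gen_rel _. Qed.

End Endo.

Lemma pconj_endoK c d :
    (forall l, l \in link e j -> commute c (vtx l)) ->
    (forall l, l \in link e j -> commute d (vtx l)) ->
    d * c = 1 -> pconj_endo d c = c -> cancel (pconj_endo c) (pconj_endo d).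
Proof.
move=> cC dC dc dE; have dM := pconj_endoM dC; have cM := pconj_endoM cC.
have dV : pconj_endo d c^-1 = c^-1.
  have d1 : pconj_endo d 1 = 1.
    by apply: (@mulgI _ (pconj_endo d 1)); rewrite -dM !mulg1.
  by apply: (@mulgI _ c); rewrite -{1}dE -dM !mulgV d1.
apply: (presented_ext (f := pconj_endo d \o pconj_endo c) (g := id)) => //.
  by move=> x y /=; rewrite cM dM.
move=> k /=; rewrite (pconj_endo_vtx cC) /pconj_gen; case: ifPn => kQ.
  have cd : c^-1 = d by apply: (@mulIg _ c); rewrite mulVg dc.
  rewrite !dM dE dV (pconj_endo_vtx dC) /pconj_gen kQ -cd invgK.
  by rewrite !mulgA mulgV mul1g mulgK.
by rewrite (pconj_endo_vtx dC) /pconj_gen (negbTE kQ).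
Qed.

Lemma partial_conj_exists :
  exists f : aut graph_product,
    is_partial_conj j Q f /\ forall g, is_partial_conj j Q g -> g = f.
Proof.
have cC l : l \in link e j -> commute (vtx j) (vtx l).
  by rewrite inE; exact: vtx_comm.
have dC l : l \in link e j -> commute (vtx j)^-1 (vtx l).
  move=> /cC jl; apply: (@mulgI _ (vtx j)).
  by rewrite mulgA mulgV mul1g mulgA jl -mulgA mulgV mulg1.
have jQ : j \notin Q.
  by apply/negP => /comp_notin_star; rewrite finset.in_setU1 eqxx.
have jE c : (forall l, l \in link e j -> commute c (vtx l)) ->
    pconj_endo c (vtx j) = vtx j.
  by move=> h; rewrite (pconj_endo_vtx h) /pconj_gen (negbTE jQ).
have cM := pconj_endoM cC.
have jV : pconj_endo (vtx j) (vtx j)^-1 = (vtx j)^-1.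
  have c1 : pconj_endo (vtx j) 1 = 1.
    by apply: (@mulgI _ (pconj_endo (vtx j) 1)); rewrite -cM !mulg1.
  by apply: (@mulgI _ (vtx j)); rewrite -{1}(jE _ cC) -cM !mulgV c1.
have K1 := pconj_endoK cC dC (mulVg _) (jE _ dC).
have K2 := pconj_endoK dC cC (mulgV _) jV.
exists (Aut cM (Bijective K1 K2)); split=> [k /=|g gP].
  by rewrite (pconj_endo_vtx cC).
apply: aut_ext; apply: presented_ext => [||k].
- exact: aut_morph.
- exact: aut_morph.
- by rewrite [LHS]gP /= (pconj_endo_vtx cC).
Qed.

End PartialConjExists.

End GraphProduct.

Arguments vtx {V} e m k.
Arguments vtx_set {V} e m D.
Arguments subgraph_vtx {V} e m D.
Arguments link_conjs {V} e m i.

(* Main.v *)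
(**
Write P_j for the subgroup generated by the vertices other than v_j. If k is
outside S_j and x^-1 v_k x lies in P_j, then x lies in P_j; this is read off a
normal form for the cosets of P_j. Hence, for phi mapping each vertex to a
conjugate, phi(v_k) in P_j and k' adjacent to k, with k and k' outside S_j,
force phi(v_k') in P_j, and this propagates along a component of Gamma \ S_j.

Let A_k be the set of those j in L_i for which the component of k in
Gamma \ S_j exists and meets L_i. If phi in <L_i> fixes W(L_i) pointwise, then
phi(v_k) is in P_j for each j in A_k, so phi(v_k) is in W(V \ A_k). But killing
A_k sends phi(v_k) to v_k for every phi in <L_i>, as this holds for the
generators, and killing vertices is compatible with maps that send each vertex
to a conjugate. So phi(v_k) = v_k for every k.
*)

Require Import Defs.
From HB Require Import structures.
From mathcomp Require Import all_boot.
From mathcomp Require Import zmodp.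
From mathcomp Require Import boolp classical_sets.

Set Implicit Arguments.
Unset Strict Implicit.
Unset Printing Implicit Defensive.

Local Open Scope group_scope.

(** * Retractions onto full subgraphs *)

Section GraphProductTheory.
Variables (V : finType) (e : rel V) (m : V -> option nat).
Local Notation W := (graph_product e m).
Local Notation vtx := (vtx e m).

Lemma graph_rel_eval (H : groupType) (f : V -> H) :
    (forall i n, m i = Some n -> f i ^+ n = 1) ->
    (forall j k, e j k -> commute (f j) (f k)) ->
  forall r s, graph_rel e m r s -> word_eval f r = word_eval f s.
Proof.
move=> f_order f_comm r s [i n mi|j k jk].
  rewrite {2}/word_eval big_nil -(f_order _ _ mi).
  elim: n {mi} => [|n IH]; first by rewrite /word_eval big_nil.
  by rewrite expgS -IH /word_eval big_cons.
by rewrite /word_eval !big_cons !big_nil /= !mulg1; exact: f_comm.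
Qed.

Lemma graph_product_ext (H : groupType) (f g : UMagmaMorphism.type W H) :
  (forall k, f (vtx k) = g (vtx k)) -> f =1 g.
Proof. by move=> fg; apply: presented_ext fg; exact: gmulfM. Qed.

(** Killing the other vertices maps [W] to a cyclic group of order at least 2 in which [v_k] becomes
    the generator [Zp1]. *)
Lemma vtx_neq1 k : m k <> Some 1%N -> vtx k != 1.
Proof.
move=> mk1.
suff [n [nz]] : exists n, (Zp1 : 'I_n.+2) != 1%g /\
    (forall p, m k = Some p -> (Zp1 : 'I_n.+2) ^+ p = 1).
  move=> ord_n; apply: contra_neq nz => vk1.
  pose f v : 'I_n.+2 := if v == k then Zp1 else 1.
  have fR : forall r s, graph_rel e m r s -> word_eval f r = word_eval f s.
    apply: graph_rel_eval => [i p|a b _].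
      rewrite /f; case: eqP => [->|_ _]; [exact: ord_n|exact: expg1n].
    by rewrite /f; do 2![case: eqP => _] => //; rewrite /commute ?mulg1 ?mul1g.
  have := presented_lift_gen fR k; rewrite /f eqxx => <-.
  rewrite -[pgen _ k]/(vtx k) vk1.
  by apply: (@mulgI _ (presented_lift f (1 : W)));
    rewrite -(presented_liftM fR) !mulg1.
have gen n : (Zp1 : 'I_n.+2) ^+ n.+2 = 1.
  by apply: val_inj; rewrite Zp_expg /= modnMl.
(* The labels [Some 0] and [None] constrain nothing, so order 2 serves for them. *)
case mkE: (m k) mk1 => [[|[|n]]|] mk1 //; [exists 0|exists n|exists 0].
- by split=> // p [<-].
- by split=> // p [<-].
- by split.
Qed.

Section Retraction.
Variable D : {set V}.

(* The retraction of W onto W(D); its fixed points are the elements of W(D). *)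
Definition retr : W -> W :=
  presented_lift (fun k => if k \in D then vtx k else 1).

Lemma retr_rel r s : graph_rel e m r s ->
  word_eval (fun k => if k \in D then vtx k else 1) r =
  word_eval (fun k => if k \in D then vtx k else 1) s.
Proof.
apply: graph_rel_eval => [i n mi|j k jk].
  by case: ifP => _; [exact: vtx_order|exact: expg1n].
case: ifP => _; last exact/commute_sym/commute1.
by case: ifP => _; [exact: vtx_comm|exact: commute1].
Qed.

Lemma retr_morphism : monoid_morphism retr.
Proof.
have rM : {morph retr : x y / x * y} := presented_liftM retr_rel.
by split=> //; apply: (@mulgI _ (retr 1)); rewrite -rM !mulg1.
Qed.

HB.instance Definition _ := isUMagmaMorphism.Build W W retr retr_morphism.

Lemma retr_vtx k : retr (vtx k) = if k \in D then vtx k else 1.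
Proof. exact: presented_lift_gen retr_rel k. Qed.

(** Consequently an element fixed by the retraction is represented by a word with all letters in
    [D]. *)
Lemma retr_word w :
  retr (word_class _ w) = word_class _ [seq l <- w | l.1 \in D].
Proof.
have letterE k b : word_class _ [:: (k, b)] = if b then (vtx k)^-1 else vtx k.
  by case: b => //; symmetry; exact: (presented_invE _ [:: (k, false)]).
elim: w => [|[k b] w IH]; first exact: (retr_morphism.1).
rewrite -cat1s word_class_cat gmulfM /= IH letterE.
have -> : retr (if b then (vtx k)^-1 else vtx k) =
    if k \in D then if b then (vtx k)^-1 else vtx k else 1.
  case: b; rewrite ?gmulfV /= retr_vtx; case: ifP => _ //; exact: invg1.
by case: ifP => _; rewrite ?mul1g // -letterE -word_class_cat.
Qed.

End Retraction.

Lemma retr_comp D E x : retr D (retr E x) = retr (D :&: E) x.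
Proof.
apply: (graph_product_ext (f := retr D \o retr E)) => k /=.
rewrite !retr_vtx finset.in_setI; case: (k \in E); rewrite ?andbT ?andbF ?gmulf1 //.
exact: retr_vtx.
Qed.

Lemma retr_set0 x : retr finset.set0 x = 1.
Proof.
apply: (graph_product_ext (f := retr finset.set0) (g := @one_fun W W)) => k.
by rewrite /= retr_vtx inE.
Qed.

Lemma retr_setT x : retr finset.setT x = x.
Proof.
by apply: (graph_product_ext (f := retr finset.setT) (g := idfun)) => k; rewrite /= retr_vtx inE.
Qed.

Lemma commute_retr (D : {set V}) x c :
  (forall k, k \in D -> commute c (vtx k)) -> commute c (retr D x).
Proof.
move=> cD; apply/commute_sym; apply/commgP; rewrite -conjg_fix; apply/eqP; move: x.
apply: (presented_ext (f := fun x => retr D x ^ c)) => [x y|x y|k].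
- by rewrite gmulfM conjMg.
- exact: gmulfM.
rewrite -[pgen _ k]/(vtx k) retr_vtx; case: ifP => kD; last exact: conj1g.
by rewrite conjgE -(cD k kD) mulKg.
Qed.

Local Notation P j := (retr (finset.setC (finset.set1 j))).

Lemma vtx_fixed j k : k != j -> P j (vtx k) = vtx k.
Proof. by move=> kj; rewrite retr_vtx !inE kj. Qed.

(** Retractions compose by intersecting, so the maps [P j] for [j] in [A] compose to the one that
    kills [A]. *)
Lemma retr_fixed (A : {set V}) x :
  (forall j, j \in A -> P j x = x) -> retr (finset.setC A) x = x.
Proof.
have [n] := ubnP #|A|; elim: n A => // n IH A.
have [->|[j jA]] := set_0Vmem A; first by rewrite finset.setC0 retr_setT.
rewrite (cardsD1 j) jA ltnS => /IH {}IH fixA.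
rewrite -(finset.setD1K jA) finset.setCU finset.setIC -retr_comp fixA //.
by apply: IH => k; rewrite finset.in_setD1 => /andP[_]; exact: fixA.
Qed.

(** A killed vertex stays killed under [f], because its image is a conjugate of it; so [f] descends
    to the quotient. *)
Lemma retr_conj (f : aut W) D x : (forall k, exists a, f (vtx k) = vtx k ^ a) ->
  retr D (f (retr D x)) = retr D (f x).
Proof.
move=> f_conj.
apply: (graph_product_ext (f := retr D \o f \o retr D) (g := retr D \o f)) => k /=.
rewrite retr_vtx; case: ifP => // kD; rewrite !gmulf1.
by have [a ->] := f_conj k; rewrite gmulfJ /= retr_vtx kD conj1g.
Qed.

End GraphProductTheory.

(** * Normal forms for the cosets of P_j *)

(* W acts on reduced sequences of letters (c, b), where c is a left coset of
   W(L_j) in P_j and b a nontrivial power of v_j. If c = g W(L_j), the letter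
   stands for g b g^-1, so that a sequence stands for an element of the normal
   closure of v_j; these elements represent the cosets of P_j in W. *)
Section CosetAction.
Variables (V : finType) (e : rel V) (m : V -> option nat) (j : V).
Hypothesis e_sym : symmetric e.
Hypothesis e_irr : irreflexive e.
Local Notation W := (graph_product e m).
Local Notation vtx := (vtx e m).
Local Notation retr := (@retr V e m).
Local Notation L := (link e j).
Local Notation P := (retr (finset.setC (finset.set1 j))).
Implicit Types (s : seq (set W * W)) (w : word V).

Definition base_coset : set W := fun x => retr L x = x.

Definition translate (a : W) (l : set W * W) : set W * W :=
  (fun x => l.1 (a^-1 * x), l.2).

Definition push (a : W) s := if a == 1 then s else (base_coset, a) :: s.

Definition base_mul (a : W) s :=
  if s is (c, b) :: s' then
    if `[< c = base_coset >] then push (a * b) s' else push a s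
  else push a [::].

Fixpoint reduced s : Prop :=
  if s is (c, b) :: s' then
    [/\ b != 1, ohead (unzip1 s') <> Some c & reduced s']
  else True.

(** For [k] other than [j], [v_k] lies in [P_j], whence [v_k s P_j = v_k s v_k^-1 P_j]; conjugating
    the product [s] translates the coset in each of its letters. *)
Definition act_letter (l : V * bool) s :=
  let a := if l.2 then (vtx l.1)^-1 else vtx l.1 in
  if l.1 == j then base_mul a s else map (translate a) s.

Definition act w s := foldr act_letter s w.

Lemma act_cat u w s : act (u ++ w) s = act u (act w s).
Proof. exact: foldr_cat. Qed.

Lemma base_commute x : base_coset x -> commute (vtx j) x.
Proof.
by move=> <-; apply: commute_retr => k; rewrite inE; exact: vtx_comm.
Qed.

Lemma translateM a b : translate (a * b) =1 translate a \o translate b.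
Proof.
by move=> [c u]; congr pair; apply/funext => x; rewrite /= invgM mulgA.
Qed.

Lemma translate1 : translate 1 =1 id.
Proof. by move=> [c u]; congr pair; apply/funext => x /=; rewrite invg1 mul1g. Qed.

Lemma translate_inj a : injective (translate a).
Proof.
apply: (can_inj (g := translate a^-1)) => l.
by rewrite -[LHS]translateM mulVg translate1.
Qed.

(** * The action of words on reduced sequences *)

Lemma reduced_push a s :
  reduced s -> ohead (unzip1 s) <> Some base_coset -> reduced (push a s).
Proof. by rewrite /push; case: eqP => // /eqP. Qed.

(** Splitting off the letter over the base coset, taken as 1 if absent, turns [base_mul] into
    multiplication in that letter. *)
Lemma reducedE s : reduced s -> exists b s',
  [/\ s = push b s', reduced s' & ohead (unzip1 s') <> Some base_coset].
Proof.
case: s => [|[c b] s] /= rs; first by exists 1, [::]; rewrite /push eqxx.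
case: (pselect (c = base_coset)) => [c_base|c_base].
  case: rs => b1 hs rs; exists b, s; split=> //; last by rewrite -c_base.
  by rewrite /push (negbTE b1) c_base.
by exists 1, ((c, b) :: s); split=> //=; [rewrite /push eqxx|case].
Qed.

Lemma base_mul_push a b s : ohead (unzip1 s) <> Some base_coset ->
  base_mul a (push b s) = push (a * b) s.
Proof.
rewrite /push; case: eqP => [->|b1] hs; last by rewrite /= asboolT.
rewrite mulg1; case: s hs => [//|[c u] s] /= hs.
by rewrite asboolF // => cb; apply: hs; rewrite cb.
Qed.

Lemma reduced_base_mul a s : reduced s -> reduced (base_mul a s).
Proof.
by case/reducedE=> b [s' [-> rs' hs']]; rewrite base_mul_push //; exact: reduced_push.
Qed.

Lemma base_mulM a b s : reduced s -> base_mul (a * b) s = base_mul a (base_mul b s).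
Proof.
by case/reducedE=> c [s' [-> rs' hs']]; rewrite !base_mul_push // mulgA.
Qed.

Lemma base_mul1 s : reduced s -> base_mul 1 s = s.
Proof.
by case/reducedE=> c [s' [-> rs' hs']]; rewrite !base_mul_push // mul1g.
Qed.

Lemma reduced_translate a s : reduced s -> reduced (map (translate a) s).
Proof.
elim: s => //= -[c b] s IH [b1 hs rs]; split=> //; last exact: IH.
case: s hs {IH rs} => //= -[c' b'] s /= hs [cc']; apply: hs; congr Some.
by have /translate_inj[] : translate a (c', b) = translate a (c, b) by congr pair.
Qed.

Lemma reduced_act_letter l s : reduced s -> reduced (act_letter l s).
Proof.
move=> rs; rewrite /act_letter; case: ifP => _.
  exact: reduced_base_mul.
exact: reduced_translate.
Qed.

Lemma reduced_act w s : reduced s -> reduced (act w s).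
Proof. by move=> rs; elim: w => //= l w; exact: reduced_act_letter. Qed.

Lemma translate_base k b : k \in L -> translate (vtx k) (base_coset, b) = (base_coset, b).
Proof.
move=> kL; congr pair; apply/funext => x; rewrite /base_coset /=; apply/propext.
by rewrite gmulfM gmulfV /= retr_vtx kL; split=> [/mulgI|->].
Qed.

(** Translation by [v_k] is injective and fixes the base coset, so it neither creates nor destroys a
    leading letter over it. *)
Lemma base_mul_translate a k s : k \in L -> reduced s ->
  base_mul a (map (translate (vtx k)) s) = map (translate (vtx k)) (base_mul a s).
Proof.
move=> kL /reducedE[b [s' [-> rs' hs']]].
have push_tr c : map (translate (vtx k)) (push c s') =
    push c (map (translate (vtx k)) s').
  by rewrite /push; case: eqP => //= _; rewrite translate_base.
rewrite push_tr !base_mul_push //.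
case: s' hs' {rs' push_tr} => //= -[c u] s' /= hs [cb]; apply: hs; congr Some.
have : translate (vtx k) (c, u) = translate (vtx k) (base_coset, u).
  by rewrite translate_base // [LHS]/translate cb.
by case/translate_inj.
Qed.

(** The one relation mixing both kinds of letters, [v_j] commuting with its link, is
    [base_mul_translate]. Reducedness enters because [base_mul] is a group action only on reduced
    sequences. *)
Lemma act_cong u w s :
  word_cong (graph_rel e m) u w -> reduced s -> act u s = act w s.
Proof.
move=> uw; elim: uw s => {u w} [//|u w _ IH s rs|u w t _ IHu _ IHw s rs|u w x b s rs|u w r t rt s rs].
- by rewrite IH.
- by rewrite IHu // IHw.
- rewrite !act_cat; congr (act u _); rewrite /= /act_letter /=.
  have {rs} : reduced (act w s) by exact: reduced_act.
  move: (act w s) => {}s rs; case: eqP => [_|_].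
    rewrite -base_mulM //; case: b => /=; rewrite ?mulVg ?mulgV; exact: base_mul1.
  rewrite -map_comp -(eq_map (translateM _ _)).
  by case: b => /=; rewrite ?mulVg ?mulgV (eq_map translate1) map_id.
rewrite !act_cat; congr (act u _).
have {rs} : reduced (act w s) by exact: reduced_act.
move: (act w s) => {u w}s rs; case: rt => [i n mi|k l kl] /=.
  have -> : act (nseq n (i, false)) s =
      if i == j then base_mul (vtx i ^+ n) s else map (translate (vtx i ^+ n)) s.
    elim: {mi} n => [|n IH] /=.
      by rewrite expg0 base_mul1 // (eq_map translate1) map_id if_same.
    rewrite IH expgS /act_letter /=; case: (i == j); first by rewrite base_mulM.
    by rewrite -map_comp -(eq_map (translateM _ _)).
  by rewrite (vtx_order e mi) base_mul1 // (eq_map translate1) map_id if_same.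
have kl_neq : k != l by apply: contraTneq kl => ->; rewrite e_irr.
rewrite /act_letter /=; case: (k =P j) => [kj|_]; case: (l =P j) => [lj|_].
- by rewrite kj lj eqxx in kl_neq.
- by rewrite kj base_mul_translate // inE -kj.
- by rewrite lj base_mul_translate // inE -lj e_sym.
- by rewrite -!map_comp -!(eq_map (translateM _ _)) vtx_comm.
Qed.

(* [s] is the normal form of the coset [x P_j]. *)
Fixpoint represents s (x : W) : Prop :=
  if s is (c, b) :: s' then
    exists g, [/\ P g = g, c = (translate g (base_coset, b)).1,
      (forall y, base_coset y -> commute b y) & represents s' (b^-1 ^ g^-1 * x)]
  else P x = x.

Lemma represents_push a s x : (forall y, base_coset y -> commute a y) ->
  represents (push a s) x <-> represents s (a^-1 * x).
Proof.
move=> aC; rewrite /push; case: eqP => [->|a1]; first by rewrite invg1 mul1g.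
split=> [[g [_ gE _]]|sx]; last first.
  by exists 1; rewrite gmulf1 invg1 conjg1 translate1; split.
(* The coset of [g] is the base coset, so [g] lies in [W(L_j)] and commutes with [a]: the letter
   stands for [a] itself. *)
have bg : base_coset g.
  have : (translate g (base_coset, a)).1 g by rewrite /= mulVg /base_coset gmulf1.
  by rewrite -gE.
have -> // : a^-1 ^ g^-1 = a^-1.
apply/eqP; rewrite conjg_fix; apply/commgP.
exact/commuteV/commute_sym/commuteV/commute_sym/aC.
Qed.

Lemma represents_base_mul a s x : (forall y, base_coset y -> commute a y) ->
  reduced s -> represents s x -> represents (base_mul a s) (a * x).
Proof.
move=> aC /reducedE[b [s' [-> _ hs']]]; rewrite base_mul_push // => sx.
have bC y : base_coset y -> commute b y.
  move: sx; rewrite /push; case: eqP => [->|_ [g [_ _ bC _]]]; last exact: bC.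
  by move=> _ _; exact/commute_sym/commute1.
apply/represents_push => [y yb|].
  by apply/commute_sym/commuteM; apply/commute_sym; [exact: aC|exact: bC].
by rewrite invgM -mulgA mulKg; apply/represents_push.
Qed.

Lemma represents_translate p s x : P p = p ->
  represents s x -> represents (map (translate p) s) (p * x).
Proof.
move=> pP; elim: s x => [|[c b] s IH] x /=; first by rewrite gmulfM /= pP => ->.
case=> g [gP -> bC sx]; exists (p * g); split=> //.
- by rewrite gmulfM /= pP gP.
- by apply/funext => y /=; rewrite invgM mulgA.
rewrite invgM conjgM.
have -> : (b^-1 ^ g^-1) ^ p^-1 * (p * x) = p * (b^-1 ^ g^-1 * x).
  by rewrite [_ ^ p^-1]conjgE invgK !mulgA mulgVK.
exact: IH.
Qed.

(** In particular an empty normal form forces the element into [P_j]; [act_fixed] is the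
    converse. *)
Lemma represents_act w : represents (act w [::]) (word_class _ w).
Proof.
elim: w => [|[k b] w IH]; first exact: (retr_morphism _ _ _).1.
rewrite -cat1s word_class_cat.
have -> : word_class (graph_rel e m) [:: (k, b)] = if b then (vtx k)^-1 else vtx k.
  by case: b => //; symmetry; exact: (presented_invE _ [:: (k, false)]).
rewrite /= /act_letter /=; case: eqP => [->|/eqP kj].
  apply: represents_base_mul => //; last exact: reduced_act.
  move=> y /base_commute jy; case: b => //; exact/commute_sym/commuteV/commute_sym.
by apply: represents_translate => //; case: b; rewrite ?gmulfV /= vtx_fixed.
Qed.

(** The word may be replaced by one without [v_j]; its letters only translate, and the empty
    sequence stays empty. *)
Lemma act_fixed w : P (word_class _ w) = word_class _ w -> act w [::] = [::].
Proof.
rewrite retr_word => /word_classP /act_cong <- //.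
elim: w => //= -[k b] w; rewrite !inE; case: eqP => //= /eqP kj IH.
by rewrite IH /act_letter /= (negbTE kj).
Qed.

(* v_k fixes the coset x P_j, hence every letter of its normal form; but v_k
   fixes no coset of W(L_j) in P_j, so the normal form is empty. *)
Lemma fixed_of_conj_vtx k x : k \notin star e j -> vtx k != 1 ->
  P (vtx k ^ x) = vtx k ^ x -> P x = x.
Proof.
rewrite finset.in_setU1 negb_or => /andP[kj kL] vk1.
elim/word_classW: x => w.
(* Applied to the empty sequence, which [v_k ^ x] fixes, this identity shows that [v_k] fixes the
   normal form of [x]. *)
have : word_class (graph_rel e m) w * (vtx k ^ word_class (graph_rel e m) w) =
   vtx k * word_class (graph_rel e m) w by rewrite -conjgC.
elim/word_classW: (vtx k ^ _) => p wp /act_fixed p0.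
move: wp; rewrite -!word_class_cat => /word_classP /act_cong.
move=> /(_ [::] I); rewrite act_cat p0 act_cat /= /act_letter /= (negbTE kj).
have := represents_act w; case: (act w [::]) => [|[c b] s] /=; first by [].
move=> [g [_ -> _ _]] [].
(* Evaluating both equal cosets at [g] puts [g^-1 v_k^-1 g] into [W(L_j)]. *)
move=> /(congr1 (fun f => f g)); rewrite /base_coset /= mulVg gmulf1 => gk _.
have {gk} : retr L (g^-1 * ((vtx k)^-1 * g)) = g^-1 * ((vtx k)^-1 * g).
  by rewrite -gk.
(* Retracting onto [v_k] alone kills [W(L_j)], but sends this element to a nontrivial conjugate of
   [v_k^-1]. *)
move=> /(congr1 (retr (finset.set1 k))); rewrite retr_comp.
have -> : finset.set1 k :&: L = finset.set0.
  by apply/finset.setP => l; rewrite !inE; case: eqP => //= ->; move: kL; rewrite inE => /negbTE.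
rewrite retr_set0 -conjgE gmulfJ gmulfV /= retr_vtx inE eqxx => /esym/eqP.
by rewrite conjg_eq1 invg_eq1 (negbTE vk1).
Qed.

End CosetAction.

(** * The group generated by L_i *)

Section LinkConjugations.
Variables (V : finType) (e : rel V) (m : V -> option nat).
Hypothesis e_sym : symmetric e.
Hypothesis e_irr : irreflexive e.
Hypothesis m_order : order_map m.
Local Notation W := (graph_product e m).
Local Notation vtx := (vtx e m).
Local Notation retr := (@retr V e m).
Local Notation P j := (retr (finset.setC (finset.set1 j))).

Lemma vtx_neq1_order k : vtx k != 1.
Proof.
apply: vtx_neq1 => /m_order[p [a [p_pr a_gt0 pa1]]].
by have := ltn_expl a (prime_gt1 p_pr); rewrite -pa1 ltnNge a_gt0.
Qed.

(** The element [y ^ a^-1] centralizes [v_k]. Two uses of [fixed_of_conj_vtx] put [a] and [y ^ a^-1]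
    into [P_j], hence also [y]. *)
Lemma fixed_commute j k a y : k \notin star e j ->
  P j (vtx k ^ a) = vtx k ^ a -> commute (vtx k ^ a) y -> P j y = y.
Proof.
move=> kj fixa cay.
have fix_conj := fixed_of_conj_vtx e_sym e_irr kj (vtx_neq1_order k).
have aP := fix_conj _ fixa.
rewrite -(conjgKV a y) gmulfJ /= aP fix_conj //.
have -> : vtx k ^ (y ^ a^-1) = vtx k.
  apply/eqP; rewrite conjg_fix; apply/commgP.
  rewrite -[vtx k](conjgK a) /commute -!conjMg.
  by congr (_ ^ _).
apply: vtx_fixed.
by apply: contraNneq kj => ->; rewrite finset.in_setU1 eqxx.
Qed.

(** The induction goes back along a path from [l] to [k]. Across an edge the two images commute, and
    [fixed_commute] applies to the one already known to lie in [P_j]. *)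
Lemma fixed_connect (f : aut W) j k l :
    (forall k, exists a, f (vtx k) = vtx k ^ a) ->
    connect (induced e (finset.setC (star e j))) k l ->
  P j (f (vtx l)) = f (vtx l) -> P j (f (vtx k)) = f (vtx k).
Proof.
move=> f_conj /connectP[p kp ->]; elim: p k kp => //= k' p IH k /andP[kk' k'p] /(IH _ k'p).
case/and3P: kk' => _; rewrite finset.in_setC => k'j kk'.
have [a fk'] := f_conj k'; rewrite {1 2}fk' => /(fixed_commute k'j).
apply; rewrite -fk'; apply: gmulf_commute; apply: vtx_comm.
by rewrite e_sym.
Qed.

Variable i : V.
Local Notation L := (link e i).

(* The [j] for which some generator [chi_{jQ}] of [<L_i>] moves [v_k]. *)
Definition active k : {set V} :=
  [set j in L | (k \notin star e j) &&
    [exists l in L, (l != j) && connect (induced e (finset.setC (star e j))) k l]].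

Lemma partial_conj_active j Q k :
  Q \in components e (finset.setC (star e j)) -> is_link_point e i j Q -> k \in Q ->
  j \in active k.
Proof.
move=> Qc /andP[jL /set0Pn[l /setIP[lQ lL]]] kQ; rewrite inE jL (comp_notin_star Qc kQ) /=.
apply/existsP; exists l; rewrite lL /=; apply/andP; split.
  apply: contraTneq lQ => ->; apply/negP => /(comp_notin_star Qc).
  by rewrite finset.in_setU1 eqxx.
case/imsetP: Qc kQ lQ => x _ ->; rewrite 2!inE => /andP[_ xk]; rewrite inE => /andP[_ xl].
apply: connect_trans xl; rewrite (sym_connect_sym _ k) // => a b.
by rewrite /induced e_sym andbCA.
Qed.

(** Taking the conjugators in [W(D)] makes [f] map [W(D)] to itself and preserve conjugacy of
    vertices inside [W(D)], not merely inside [W]. *)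
Definition conj_in (D : {set V}) (f : aut W) : Prop :=
  forall k, exists2 a, generated (vtx_set e m D) a & f (vtx k) = vtx k ^ a.

Lemma conj_in_generated D f x : conj_in D f ->
  generated (vtx_set e m D) x -> generated (vtx_set e m D) (f x).
Proof.
move=> fD; elim=> [_ [k kD ->]||y z _ fy _ fz|y _ fy].
- have [a aD ->] := fD k; apply: generatedM (generatedV aD) _.
  by apply: generatedM aD; apply: generated_in; exists k.
- by rewrite gmulf1; exact: generated1.
- by rewrite gmulfM; exact: generatedM.
- by rewrite gmulfV; exact: generatedV.
Qed.

Lemma conj_inM D f g : conj_in D f -> conj_in D g -> conj_in D (f * g).
Proof.
move=> fD gD k; have [a aD ga] := gD k; have [b bD fb] := fD k.
exists (b * f a); first by apply: generatedM bD _; exact: conj_in_generated.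
by rewrite autME ga gmulfJ /= fb conjgM.
Qed.

Lemma conj_in1 D : conj_in D 1.
Proof. by move=> k; exists 1; [exact: generated1|rewrite conjg1]. Qed.

(** Carrying the inverse along reduces the case of inverses to a swap. A generator fixes its own
    [v_j], so its inverse conjugates [Q] by [v_j^-1]. *)
Lemma link_conjs_conj_in f : generated (link_conjs e m i) f ->
  conj_in L f /\ conj_in L f^-1.
Proof.
elim=> [{}f [j [Q [Qc fE /andP[jL _]]]]||g h _ [gL gL'] _ [hL hL']|g _ [gL gL']].
- have vj : generated (vtx_set e m L) (vtx j) by apply: generated_in; exists j.
  have fj : f (vtx j) = vtx j.
    rewrite fE; case: ifP => // /(comp_notin_star Qc).
    by rewrite finset.in_setU1 eqxx.
  split=> k.
    rewrite fE; case: ifP => _; last by exists 1; [exact: generated1|rewrite conjg1].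
    by exists (vtx j)^-1; [exact: generatedV|rewrite conjgE invgK mulgA].
  have fVE x y : f x = y -> f^-1 y = x by move=> <-; exact: autK.
  case kQ: (k \in Q).
    exists (vtx j) => //; apply: fVE.
    by rewrite gmulfJ /= fj fE kQ conjgE mulgVK mulKg.
  exists 1; first exact: generated1.
  by rewrite conjg1; apply: fVE; rewrite fE kQ.
- by rewrite invg1; split; exact: conj_in1.
- by rewrite invgM; split; exact: conj_inM.
- by rewrite invgK.
Qed.

(** A generator moving [v_k] conjugates it by some killed [v_j]. For products and inverses,
    [retr_conj] allows retracting before the outer map is applied. *)
Lemma link_conjs_retr f k : generated (link_conjs e m i) f ->
  retr (finset.setC (active k)) (f (vtx k)) = vtx k.
Proof.
have kA : k \in finset.setC (active k).
  by rewrite inE inE finset.in_setU1 eqxx andbF.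
have retr_k : retr (finset.setC (active k)) (vtx k) = vtx k by rewrite retr_vtx kA.
have conjE g : conj_in L g -> forall l, exists a, g (vtx l) = vtx l ^ a.
  by move=> gL l; have [a _ ga] := gL l; exists a.
elim=> [{}f [j [Q [Qc fE jQ]]]||g h gL IHg _ IHh|g gL IHg].
- rewrite fE; case: ifP => // /(partial_conj_active Qc jQ) jA.
  by rewrite gmulfF gmulfM /= retr_k retr_vtx inE jA /= mul1g divg1.
- exact: retr_k.
- have [/conjE/retr_conj gE _] := link_conjs_conj_in gL.
  by rewrite autME -gE IHh.
- have [_ /conjE/retr_conj gE] := link_conjs_conj_in gL.
  by rewrite -{1}IHg gE -autME mulVg aut1E.
Qed.

Lemma link_conjs_eq1 f : generated (link_conjs e m i) f ->
  (forall k, k \in L -> f (vtx k) = vtx k) -> f = 1.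
Proof.
move=> fL f1; apply: aut_ext; apply: graph_product_ext => k /=.
rewrite -[RHS](link_conjs_retr k fL); symmetry; apply: retr_fixed => j.
rewrite inE => /and3P[_ kj /existsP[l /and3P[lL lj kl]]].
(* The vertex [l] of [L_i] starts the propagation: [f] fixes [v_l], which lies in [P_j] since
   [l != j]. *)
apply: fixed_connect kl _ => [v|].
  by have [/(_ v)[a _ fa] _] := link_conjs_conj_in fL; exists a.
by rewrite f1 // vtx_fixed.
Qed.

(** The hypothesis on [f^-1] provides the inverse of the restricted map. *)
Lemma conj_in_restrict D f : conj_in D f -> conj_in D f^-1 ->
  exists g : aut0 (subgraph_vtx e m D), forall x, val (val g x) = f (val x).
Proof.
move=> fD fVD.
have genP (x : gengroup (vtx_set e m D)) : generated (vtx_set e m D) (val x).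
  exact/asboolP/(valP x).
pose res g (gD : conj_in D g) (x : gengroup (vtx_set e m D)) :
    gengroup (vtx_set e m D) :=
  GenGroup (introT (asboolP _) (conj_in_generated gD (genP x))).
have resM g gD : {morph @res g gD : x y / x * y}.
  by move=> x y; apply: val_inj; rewrite /= gmulfM.
have resK : cancel (res f fD) (res _ fVD).
  by move=> x; apply: val_inj; exact: autK.
have resVK : cancel (res _ fVD) (res f fD).
  by move=> x; apply: val_inj; exact: autVK.
have g_conj : conj_preservingb (subgraph_vtx e m D)
    (Aut (resM f fD) (Bijective resK resVK)).
  apply/asboolP => v [k _ vk]; have [a aD fa] := fD k.
  exists (GenGroup (introT (asboolP _) aD)); apply: val_inj.
  by rewrite /= vk fa.
by exists (Aut0 g_conj).
Qed.

End LinkConjugations.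

(** * The restriction homomorphism and its injectivity *)

Theorem theorem1p8 (V : finType) (e : rel V) (m : V -> option nat)
    (e_sym : symmetric e) (e_irr : irreflexive e) (m_order : order_map m)
    (i : V) :
  exists rho : {multiplicative gengroup (link_conjs e m i) ->
                  aut0 (subgraph_vtx e m (link e i))},
    (forall (phi : gengroup (link_conjs e m i))
            (x : gengroup (vtx_set e m (link e i))),
        val (val (rho phi) x) = val phi (val x)) /\
    injective rho.
Proof.
have genP (phi : gengroup (link_conjs e m i)) : generated (link_conjs e m i) (val phi).
  exact/asboolP/(valP phi).
have res phi := conj_in_restrict (link_conjs_conj_in (genP phi)).1
  (link_conjs_conj_in (genP phi)).2.
(* Restrictions are picked by choice, but [rhoE] determines each one pointwise, which makes [rho]
   multiplicative. *)
pose rho phi := sval (cid (res phi)).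
have rhoE phi x : val (val (rho phi) x) = val phi (val x) := svalP (cid (res phi)) x.
have rhoM : {morph rho : phi psi / phi * psi}.
  move=> phi psi; apply: val_inj; apply: aut_ext => x; apply: val_inj.
  by rewrite rhoE /= !rhoE.
exists (HB.pack_for {multiplicative _ -> _} rho (isMultiplicative.Build _ _ rho rhoM)).
split=> // phi psi eq_rho.
suff /mulg1_eq : psi^-1 * phi = 1 by rewrite invgK.
apply/val_inj/(link_conjs_eq1 e_sym e_irr m_order (genP _)) => k kL.
have vk : generatedb (vtx_set e m (link e i)) (vtx e m k).
  by apply/asboolP/generated_in; exists k.
have phi_psi : val phi (vtx e m k) = val psi (vtx e m k).
  rewrite -(rhoE phi (GenGroup vk)) -(rhoE psi (GenGroup vk)).
  by have -> : rho phi = rho psi := eq_rho.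
have -> : val (psi^-1 * phi) = (val psi)^-1 * val phi by [].
by rewrite autME phi_psi; exact: autK.
Qed.
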